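(* Let $\mathcal{A}=\langle A,R\rangle$ be an almost bounded structure and let $\mathcal{A}^*$ be an ultrapower of $\mathcal{A}$ modulo some $\aleph_1$-incomplete ultrafilter. Then $\Lambda(\mathcal{A}^{\mathfrak{ue}})=\Lambda((\mathcal{A}^{\mathfrak{ue}})^{\mathfrak{ue}})=\Lambda(\mathcal{A}^* )$.
   Context: All structures are of the form $\mathcal{A}=\langle A,R\rangle$ with a single binary relation $R\subseteq A\times A$. $\mathcal{A}$ is bounded if there is a finite number that bounds the in-degree and out-degree of every node of $\mathcal{A}$. $\mathcal{A}$ is almost bounded if, except for finitely many nodes with infinite degree (infinitely many $R$-successors or infinitely many $R$-predecessors), $\mathcal{A}$ is bounded; i.e. only finitely many nodes have infinite degree and there is a finite bound on the in- and out-degrees of all the other nodes. The ultrafilter extension of $\mathcal{A}$ is $\mathcal{A}^{\mathfrak{ue}}=\langle \mathrm{Uf}(A),R^{\mathfrak{ue}}\rangle$, where $\mathrm{Uf}(A)$ is the set of all ultrafilters over $A$ and $R^{\mathfrak{ue}}(u,v)$ holds iff $\{R[X]:X\in u\}\subseteq v$ (equivalently $\{\langle R\rangle(X):X\in v\}\subseteq u$), with $R[X]=\{s:(\exists w\in X)\,R(w,s)\}$ and $\langle R\rangle(X)=\{w:(\exists s\in X)\,R(w,s)\}$. An ultrafilter is $\aleph_1$-incomplete if it is not closed under countable intersections. Basic modal formulas (propositional variables from a set $\mathsf{Prop}$, Boolean connectives, one unary $\diamondsuit$) are interpreted in a structure in the usual Kripke way: for a valuation $V:\mathsf{Prop}\to\mathcal{P}(A)$,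 $\diamondsuit\varphi$ is true at $w$ iff $\varphi$ is true at some $v$ with $R(w,v)$. $\mathcal{A}\Vdash\varphi$ means that $\varphi$ is true at every $w\in A$ under every valuation $V$, and $\Lambda(\mathcal{A})=\{\varphi:\mathcal{A}\Vdash\varphi\}$. *)

(* Defs.v *)
From mathcomp Require Import all_boot.
From mathcomp Require Import mathcomp_extra boolp classical_sets functions.
From mathcomp Require Import cardinality filter.

Set Implicit Arguments.
Unset Strict Implicit.
Unset Printing Implicit Defensive.

Local Open Scope classical_set_scope.
Local Open Scope card_scope.

Record structure := Structure {
  domain :> Type;
  edge : domain -> domain -> Prop
}.

Section Degrees.
Variable A : structure.

Definition successors (a : A) : set A := [set b | edge a b].
Definition predecessors (a : A) : set A := [set b | edge b a].

Definition infinite_degree (a : A) : Prop :=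
  infinite_set (successors a) \/ infinite_set (predecessors a).

Definition degrees_le (n : nat) (a : A) : Prop :=
  successors a #<= `I_n /\ predecessors a #<= `I_n.

Definition almost_bounded : Prop :=
  finite_set [set a | infinite_degree a] /\
  exists n : nat, forall a : A, ~ infinite_degree a -> degrees_le n a.

End Degrees.

Section UltrafilterExtension.
Variable A : structure.

Definition rel_image (X : set A) : set A :=
  [set s | exists2 w, X w & edge w s].

Definition ultrafilter : Type := {u : set_system A | UltraFilter u}.

Definition ue : structure :=
  @Structure ultrafilter
    (fun u v => [set rel_image X | X in proj1_sig u] `<=` proj1_sig v).

End UltrafilterExtension.

Definition aleph1_incomplete (I : Type) (D : set_system I) : Prop :=
  exists F : nat -> set I, (forall n, D (F n)) /\ ~ D (\bigcap_n F n).

Section Ultrapower.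
Variables (A : structure) (I : Type) (D : set_system I).

Definition eq_mod (f g : I -> A) : Prop := D [set i | f i = g i].

Definition mod_class : Type :=
  {C : set (I -> A) | exists f, C = [set g | eq_mod f g]}.

(* When D is a filter, D [set i | edge (f i) (g i)] does not depend on the
   representatives f and g. *)
Definition ultrapower : structure :=
  @Structure mod_class
    (fun C1 C2 => exists f g, [/\ proj1_sig C1 f, proj1_sig C2 g &
       D [set i | edge (f i) (g i)]]).

End Ultrapower.

Section ModalLogic.
Variable Var : Type.

Inductive formula :=
  | FVar of Var
  | FBot
  | FNeg of formula
  | FOr of formula & formula
  | FDia of formula.

Fixpoint true_at (A : structure) (V : Var -> set A) (w : A) (phi : formula) :
    Prop :=
  match phi with
  | FVar p => V p w
  | FBot => False
  | FNeg psi => ~ true_at V w psi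
  | FOr psi chi => true_at V w psi \/ true_at V w chi
  | FDia psi => exists2 v, edge w v & true_at V v psi
  end.

Definition valid (A : structure) (phi : formula) : Prop :=
  forall (V : Var -> set A) (w : A), true_at V w phi.

Definition Lambda (A : structure) : set formula := [set phi | valid A phi].

End ModalLogic.

Arguments Lambda : clear implicits.

(* Main.v *)
Require Import Defs.
From mathcomp Require Import all_boot.
From mathcomp Require Import boolp classical_sets filter.
From mathcomp Require Import functions cardinality.
From mathcomp Require Import zify.
From Stdlib Require List.

Set Implicit Arguments.
Unset Strict Implicit.
Unset Printing Implicit Defensive.

Local Open Scope classical_set_scope.

(** Away from its finitely many nodes of infinite degree, an almost bounded
    structure has degrees at most n. Numbering the successors and the
    predecessors of every node from 0 to n - 1 splits the edges between
    ordinary nodes into finitely many partial injections, one for each pair of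
    numbers (almost_bounded_presentation). Together with the partial identities
    that say how a point is related to the special nodes, these are the letters
    of a countable set of words, each of which acts as a partial injection
    (run). The type of a point is the set of words that fix it. It determines
    the whole component of the point: whether a word is defined at x, and
    whether two words send x to the same point, are questions of whether some
    word fixes x. Hence two points of the same type have isomorphic components,
    related in the same way to the special nodes (component_transport).

    Both constructions carry such a presentation along: a word w acts on
    ultrafilters by pushing forward, and on an ultrapower coordinatewise. A
    class [f] is fixed by w iff almost all f i are; an ultrafilter u is fixed
    by w iff it contains the set of points fixed by w, because the remaining
    points of the domain of w split into three sets disjoint from their images
    (pushed_self). So a point b of the extension that does not come from A
    has a type of which every finite part has infinitely many realizations
    in A.
    Conversely a countable type whose finite parts have infinitely many
    realizations in A is realized by a new point, which can even be kept out of
    countably many prescribed components: in ue A by a diagonal construction of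
    an ultrafilter, in the ultrapower by using that D is aleph1-incomplete.
    These properties are collected in saturated_extension, and they are
    preserved by composition, so ue A, ue (ue A) and the ultrapower all are
    saturated extensions of A.

    Finally, two saturated extensions B1 and B2 of A validate the same formulas
    (Lambda_saturated). Mapping every component of B1 isomorphically to a
    component of B2 whose points have the same types gives a map that preserves
    edges and reflects those that leave an ordinary node. A valuation on B2 can
    be pulled back along it; truth of a formula is then preserved as soon as
    the image contains, for every special node and every subformula, one
    successor witnessing a diamond. These are finitely many points, and
    saturation allows the map to be chosen with any finite set in its image. *)

(** * Ultrafilters *)

Section UltrafilterFacts.
Variables (T : Type) (F : set_system T).
Hypothesis FU : UltraFilter F.

Lemma ultraC (X : set T) : F (~` X) <-> ~ F X.
Proof.
split=> [FC FX|nFX]; last by case: (in_ultra_setVsetC X FU).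
by apply: (filter_not_empty F); rewrite -(setICr X); apply: filterI.
Qed.

Lemma ultra_meet (X Y : set T) : F X -> F Y -> X `&` Y !=set0.
Proof. by move=> FX FY; apply: (@filter_ex _ F); apply: filterI. Qed.

Lemma ultra_exists (K : finType) (P : K -> set T) :
  F [set x | exists k, P k x] -> exists k, F (P k).
Proof.
move=> FP; apply: contrapT => /forallNP nFP.
have /filter_forall FC k : F (~` P k) by apply/ultraC.
by have [x [[k Pkx] /(_ k)]] := ultra_meet FP FC.
Qed.

Lemma ultra_or (X Y : set T) : F (X `|` Y) -> F X \/ F Y.
Proof.
move=> FXY; have [|nFX] := pselect (F X); [by left|right].
have /ultraC FCX := nFX; apply: filterS (filterI FXY FCX) => x.
by case=> -[].
Qed.

Lemma finite_set_enum (X : set T) : finite_set X ->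
  exists k (c : 'I_k -> T), forall x, X x <-> exists i, x = c i.
Proof.
move=> /(@finite_seqP {classic T})[s ->].
exists (size s), (tnth (in_tuple s)) => x /=.
by split=> [/(tnthP (in_tuple s))|?]; last exact/(tnthP (in_tuple s)).
Qed.

Lemma ultra_finite_set (X : set T) :
  finite_set X -> F X -> exists a, F [set a].
Proof.
move=> /finite_set_enum[k [c Xc]] FX.
suff [i Fi] : exists i, F [set c i] by exists (c i).
by apply: ultra_exists; apply: filterS FX => x /Xc[i ->]; exists i.
Qed.

End UltrafilterFacts.

Lemma ultra_intro T (F : set_system T) :
  (forall X Y, F X -> X `<=` Y -> F Y) ->
  (forall X Y, F X -> F Y -> F (X `&` Y)) ->
  (forall X, F (~` X) <-> ~ F X) -> F setT -> UltraFilter F.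
Proof.
move=> Fup FI FC FT.
have FF : Filter F by split=> // P Q PQ FP; apply: Fup FP PQ.
have F0 : ~ F set0 by rewrite -setCT => /FC.
split=> [//|G GF FG]; apply/seteqP; split=> // X GX.
apply: contrapT => /FC /FG GCX.
by apply: (filter_not_empty G); rewrite -(setICr X); apply: filterI.
Qed.

(** For decreasing sets X the tails of the sequence are subsets of the X n with
    empty intersection: an ultrafilter containing all tails contains all X n
    and is not principal. *)
Lemma infinite_sets_choice T (X : nat -> set T) :
  (forall n, infinite_set (X n)) ->
  exists a : nat -> T, injective a /\ forall n, X n (a n).
Proof.
move=> Xinf.
have fresh (p : nat * seq T) : exists x, X p.1 x /\ ~ List.In x p.2.
  have fin_l : finite_set [set x | List.In x p.2].
    elim: p.2 => [|y l IHl].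
      by rewrite (_ : [set _ | _] = set0) //; apply/seteqP; split.
    rewrite (_ : [set _ | _] = y |` [set x | List.In x l]).
      by rewrite finite_setU; split=> //; exact: finite_set1.
    by apply/seteqP; split=> x /= [->|?]; [left|right|left|right].
  have /infinite_setN0[x []] := infinite_setD (Xinf p.1) fin_l.
  by exists x.
have [g gP] := choice fresh.
(* L n lists the terms chosen before stage n, most recent first. *)
pose L := fix L n := if n is m.+1 then g (m, L m) :: L m else [::].
exists (fun n => g (n, L n)); split=> [|n]; last by have [] := gP (n, L n).
have inL m n : m < n -> List.In (g (m, L m)) (L n).
  by elim: n => // n IHn; rewrite ltnS leq_eqVlt => /predU1P[->|/IHn]; [left|right].
move=> m n; have [/inL H E|/inL H E|//] := ltngtP m n.
  by have [_] := gP (n, L n); rewrite -E in H *; case.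
by have [_] := gP (m, L m); rewrite E in H *; case.
Qed.

Section Diagonal.
Variables (T : Type) (a : nat -> T) (v : nat -> set_system T).
Hypothesis a_inj : injective a.
Hypothesis v_disj : forall m X Y, v m X -> v m Y -> X `&` Y !=set0.

(** Stage m + 1 keeps half of the terms of stage m, at odd or at positive even
    ranks, whichever is not in v m. Rank 0 is dropped in both cases, so that
    the subsequences leave every finite part of the sequence. *)
Fixpoint subseq_avoiding n k :=
  if n is m.+1 then
    let s := subseq_avoiding m in
    s (k.*2.+1 + `[< v m [set a (s j.*2.+1) | j in setT] >])
  else k.

Let Z n := [set a (subseq_avoiding n k) | k in setT].

Let subseq_inj n : injective (subseq_avoiding n).
Proof. by elim: n => //= n IHn j k /IHn; lia. Qed.

Let subseq_ge n k : n + k <= subseq_avoiding n k.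
Proof.
elim: n k => //= n IHn k.
by set b := nat_of_bool _; have := IHn (k.*2.+1 + b); lia.
Qed.

Let Z_decr m n : m <= n -> Z n `<=` Z m.
Proof.
move=> /subnK <-; elim: (n - m) => // d IHd; apply: subset_trans IHd.
by rewrite addSn => _ [k _ <-] /=; eexists.
Qed.

Let Z_avoid n : ~ v n (Z n.+1).
Proof.
rewrite /Z /=; case: asboolP => [vE vO|vE vO]; last first.
  by apply: vE; under eq_imagel do rewrite -[_.+1]addn0.
by have [_ [[j _ <-] [k _ /a_inj/subseq_inj]]] := v_disj vE vO; lia.
Qed.

(** The sets of terms kept at the successive stages are nonempty and
    decreasing, hence belong to a common ultrafilter U. That U differs from
    every ultrafilter among the v m, and it contains all tails of the
    sequence a. *)
Lemma ultra_diagonal : exists U : set_system T,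
  [/\ UltraFilter U, forall n, U [set a m | m in [set m | n <= m]]
    & forall m, exists2 X, U X & ~ v m X].
Proof.
have FF : ProperFilter (filter_from setT Z).
  apply: filter_from_proper; last by move=> n _; exists (a (subseq_avoiding n 0)), 0.
  apply: filter_fromT_filter; first by exists 0.
  move=> i j; exists (maxn i j) => x Zx.
  by split; apply: Z_decr Zx; rewrite ?leq_maxl ?leq_maxr.
have [U [UU FU]] := ultraFilterLemma FF; exists U; split=> // [n|m].
  apply: FU; exists n => // _ [k _ <-]; exists (subseq_avoiding n k) => //=.
  by have := subseq_ge n k; lia.
by exists (Z m.+1); [apply: FU; exists m.+1|exact: Z_avoid].
Qed.

End Diagonal.

(** * Partial injections *)

Section PartialInjections.
Variable T : Type.

Definition partial_injection (r : T -> T -> Prop) :=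
  (forall x y y', r x y -> r x y' -> y = y') /\
  (forall x x' y, r x y -> r x' y -> x = x').

(** Take for Y None a maximal set among those disjoint from their image under
    r, and for the other two sets its preimage and its image: a point in none
    of the three that has an image and is not fixed could be added to the
    maximal set. *)
Lemma three_sets (r : T -> T -> Prop) : partial_injection r ->
  exists Y : option bool -> set T,
    (forall x, (exists y, r x y) -> ~ r x x -> exists k, Y k x) /\
    (forall k x y, Y k x -> r x y -> ~ Y k y).
Proof.
move=> [rfun rinj].
pose indep (Y : set T) := forall x y, Y x -> r x y -> ~ Y y.
have [|Y [Yindep Ymax]] := @Zorn_bigcup T indep.
  move=> G Gindep Gtot x y [X GX Xx] rxy [X' GX' X'y].
  have [/(_ _ Xx) X'x|/(_ _ X'y) Xy] := Gtot _ _ GX GX'.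
    exact: Gindep X'x rxy X'y.
  exact: Gindep Xx rxy Xy.
exists (fun k => match k with
  | None => Y
  | Some true => [set x | exists2 y, Y y & r x y]
  | Some false => [set y | exists2 x, Y x & r x y] end).
split=> [x [y rxy] nrxx|[[|]|] x y /=].
- apply: contrapT => /forallNP nY.
  have nYx : ~ Y x by move=> Yx; apply: (nY None).
  apply: (Ymax (Y `|` [set x])).
    split=> [|YxY]; first by move=> z; left.
    by apply: nYx; apply: YxY; right.
  move=> z t [Yz|->] rzt [Yt|tx].
  + exact: Yindep Yz rzt Yt.
  + by rewrite tx in rzt; apply: (nY (Some false)); exists z.
  + by apply: (nY (Some true)); exists t.
  + by apply: nrxx; rewrite -[X in r _ X]tx.
- move=> [z Yz rxz] rxy [t Yt ryt].
  by have yz := rfun _ _ _ rxy rxz; subst z; exact: Yindep Yz ryt Yt.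
- move=> [z Yz rzx] rxy [t Yt rty].
  by have xt := rinj _ _ _ rxy rty; subst t; exact: Yindep Yz rzx Yt.
- exact: Yindep.
Qed.

End PartialInjections.

Lemma partial_injection_converse T (r : T -> T -> Prop) :
  partial_injection r -> partial_injection (fun x y => r y x).
Proof.
by move=> [rfun rinj]; split=> [x y y'|x x' y]; [apply: rinj|apply: rfun].
Qed.

Lemma partial_injection_comp T (r s : T -> T -> Prop) :
  partial_injection r -> partial_injection s ->
  partial_injection (fun x y => exists2 z, r x z & s z y).
Proof.
move=> [rfun rinj] [sfun sinj]; split=> [x y y'|x x' y] [z xz zy] [z' xz' zy'].
  by have zz' := rfun _ _ _ xz xz'; subst z'; apply: sfun zy zy'.
by have zz' := sinj _ _ _ zy zy'; subst z'; apply: rinj xz xz'.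
Qed.

Lemma partial_injection_id T (P : T -> Prop) :
  partial_injection (fun x y => x = y /\ P x).
Proof. by split=> [x y y'|x x' y] [<- _] [<-]. Qed.

(** * Structures presented by partial injections *)

Section Presentations.
Variables E S : finType.

(** The partial injections cover all edges except those at special nodes.
    Finiteness of E and S is what makes this cover pass to ultrafilter
    extensions and ultrapowers. *)
Record presentation (B : structure) := Presentation {
  move : E -> B -> B -> Prop;
  special : S -> B;
  move_pinj : forall e, partial_injection (move e);
  move_edge : forall e x y, move e x y -> edge x y;
  edge_cases : forall x y : B, edge x y ->
    [\/ exists e, move e x y, exists s, x = special s
      | exists s, y = special s]
}.

(** Besides the moves, each special node s gives three partial identities: at
    s itself, on the successors of s and on the predecessors of s. Treating
    these marks as letters makes a single kind of atomic statement, a word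
    fixes a point, sufficient to describe types. The boolean attached to a
    letter in a word is false when the letter is read backward. *)
Definition letter : Type := (E + S * option bool)%type.
Definition word : Type := seq (letter * bool).
Definition code (w : word) : nat := pickle w.

Section Runs.
Variables (B : structure) (P : presentation B).

Definition mark (m : S * option bool) (x : B) : Prop :=
  match m.2 with
  | None => x = special P m.1
  | Some true => edge (special P m.1) x
  | Some false => edge x (special P m.1)
  end.

Definition step (l : letter) : B -> B -> Prop :=
  match l with
  | inl e => move P e
  | inr m => fun x y => x = y /\ mark m x
  end.

Definition dstep (d : letter * bool) : B -> B -> Prop :=
  if d.2 then step d.1 else fun x y => step d.1 y x.

Fixpoint run (w : word) : B -> B -> Prop :=
  if w is d :: w' then fun x y => exists2 z, dstep d x z & run w' z y
  else fun x y => x = y.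

Definition backward (w : word) : word := rev [seq (d.1, ~~ d.2) | d <- w].

Definition connected (x y : B) : Prop := exists w, run w x y.

Lemma step_pinj l : partial_injection (step l).
Proof.
by case: l => [e|m]; [apply: move_pinj|apply: partial_injection_id].
Qed.

Lemma dstep_pinj d : partial_injection (dstep d).
Proof.
rewrite /dstep; case: d.2; first exact: step_pinj.
exact: partial_injection_converse (step_pinj _).
Qed.

Lemma run_pinj w : partial_injection (run w).
Proof.
elim: w => [|d w IHw] /=; first by split=> [x y y'|x x' y] ->.
exact: partial_injection_comp (dstep_pinj d) IHw.
Qed.

Lemma run_fun w x y y' : run w x y -> run w x y' -> y = y'.
Proof. by have [h _] := run_pinj w; apply: h. Qed.

Lemma run_inj w x x' y : run w x y -> run w x' y -> x = x'.
Proof. by have [_ h] := run_pinj w; apply: h. Qed.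

Lemma run_cat v w x y : run (v ++ w) x y <-> exists2 z, run v x z & run w z y.
Proof.
elim: v x => [|d v IHv] x /=.
  by split=> [|[z ->]] //; exists x.
split=> [[z xz /IHv[t zt ty]]|[t [z xz zt] ty]].
  by exists t => //; exists z.
by exists z => //; apply/IHv; exists t.
Qed.

Lemma run_backward w x y : run (backward w) x y <-> run w y x.
Proof.
elim: w x y => [|[l b] w IHw] x y; first by rewrite /backward /=; split=> ->.
rewrite /backward /= rev_cons -cats1 run_cat.
have dstepN z : dstep (l, ~~ b) z y <-> dstep (l, b) y z.
  by rewrite /dstep /=; case: b.
split=> [[z /IHw zx [t zt ty]]|[z /dstepN yz zx]].
  by subst t; exists z => //; apply/dstepN.
by exists z; [apply/IHw|exists y].
Qed.

(** This and the next two lemmas express everything about the component of x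
    through words that fix x. *)
Lemma run_conj v w x z : run v x z -> run w z z <-> run (v ++ w ++ backward v) x x.
Proof.
move=> xz; split=> [zz|/run_cat[z1 xz1 /run_cat[z2 z12 /run_backward xz2]]].
  by apply/run_cat; exists z => //; apply/run_cat; exists z => //; apply/run_backward.
by rewrite -(run_fun xz xz1) -(run_fun xz xz2) in z12.
Qed.

Lemma run_compare v w x z z' : run v x z -> run w x z' ->
  z = z' <-> run (v ++ backward w) x x.
Proof.
move=> xz xz'; split=> [zz'|/run_cat[t xt /run_backward xt']].
  by apply/run_cat; exists z => //; apply/run_backward; rewrite zz'.
by rewrite (run_fun xz xt) (run_fun xz' xt').
Qed.

Lemma run_defined w x : (exists y, run w x y) <-> run (w ++ backward w) x x.
Proof.
rewrite run_cat; split=> [[y xy]|[y xy _]]; last by exists y.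
by exists y => //; apply/run_backward.
Qed.

Lemma connected_refl x : connected x x. Proof. by exists [::]. Qed.

Lemma connected_sym x y : connected x y -> connected y x.
Proof. by move=> [w xy]; exists (backward w); apply/run_backward. Qed.

Lemma connected_trans x y z : connected x y -> connected y z -> connected x z.
Proof. by move=> [v xy] [w yz]; exists (v ++ w); apply/run_cat; exists y. Qed.

(** The code of words is injective, so only finitely many words are compared:
    agrees n p is the n-th finite part of the type p. *)
Definition agrees (n : nat) (p : word -> Prop) (x : B) : Prop :=
  forall w, code w < n -> (run w x x <-> p w).

Lemma agrees_antimono m n p : m <= n -> agrees n p `<=` agrees m p.
Proof. by move=> mn x xp w wm; apply: xp; apply: leq_trans mn. Qed.

End Runs.

Definition same_type (B1 B2 : structure) (P1 : presentation B1)
    (P2 : presentation B2) (x : B1) (y : B2) : Prop :=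
  forall w, run P1 w x x <-> run P2 w y y.

(** B consists of a copy of A, which is a union of components, and of new
    points. The types of the new points are those whose finite parts all have
    infinitely many realizations in A. Finiteness of the number of realizations
    is the obstruction to new points: a finite definable subset of A gets no
    new elements. The sequence z allows new components to be chosen apart from
    given ones. *)
Record saturated_extension (A B : structure) (PA : presentation A)
    (PB : presentation B) (i : A -> B) : Prop := {
  ext_inj : injective i;
  ext_run : forall w a y,
    run PB w (i a) y <-> exists2 a', y = i a' & run PA w a a';
  ext_approx : forall b, ~ range i b ->
    forall n, infinite_set (agrees PA n (fun w => run PB w b b));
  ext_realize : forall (p : word -> Prop) (z : nat -> B),
    (forall n, infinite_set (agrees PA n p)) ->
    exists b, [/\ ~ range i b, forall w, run PB w b b <-> p w
      & forall k, ~ connected PB (z k) b]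
}.

Lemma ext_type A B (PA : presentation A) (PB : presentation B) i :
  saturated_extension PA PB i -> forall a, same_type PA PB a (i a).
Proof.
move=> iext a w; rewrite (ext_run iext); split=> [aa|[a' /(ext_inj iext) <- //]].
by exists a.
Qed.

Lemma agrees_image A B (PA : presentation A) (PB : presentation B) i :
  saturated_extension PA PB i ->
  forall n p, infinite_set (agrees PA n p) -> infinite_set (agrees PB n p).
Proof.
move=> iext n p; apply: contra_not => finB.
have finA : finite_set (i @^-1` agrees PB n p).
  by apply: finite_preimage finB => a a' _ _ /(ext_inj iext).
by apply: sub_finite_set finA => a ap w wn; rewrite -(ext_type iext); apply: ap.
Qed.

(** For ext_approx at a point c that is new over B: if a finite part of the
    type of c had only finitely many realizations in A, then all its
    realizations in B would come from A, as a new one would contradict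
    ext_approx for A and B; so there would be finitely many in B, against
    ext_approx for B and C. *)
Lemma saturated_extension_comp A B C (PA : presentation A)
    (PB : presentation B) (PC : presentation C) i j :
  saturated_extension PA PB i -> saturated_extension PB PC j ->
  saturated_extension PA PC (j \o i).
Proof.
move=> iext jext; split.
- exact: inj_comp (ext_inj jext) (ext_inj iext).
- move=> w a y; rewrite (ext_run jext).
  split=> [[_ -> /(ext_run iext)[a' ->]]|[a' -> aa']]; first by exists a'.
  by exists (i a') => //; apply/(ext_run iext); exists a'.
- move=> c nic n.
  have [[b _ bc]|njc] := pselect (range j c).
    subst c; have nib : ~ range i b.
      by move=> [a _ ab]; apply: nic; exists a; rewrite /= ?ab.
    have := ext_approx iext nib (n := n); apply: contra_not; apply: sub_finite_set.
    by move=> a aP w wn; exact: iff_trans (aP w wn) (ext_type jext b w).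
  have infB := ext_approx jext njc (n := n).
  have [[b nib bP]|ib] :=
    pselect (exists2 b, ~ range i b & agrees PB n (fun w => run PC w c c) b).
    have := ext_approx iext nib (n := n); apply: contra_not; apply: sub_finite_set.
    by move=> a aP w wn; exact: iff_trans (aP w wn) (bP w wn).
  apply: contra_not infB => finA; apply: sub_finite_set (finite_image i finA).
  move=> b bP.
  have [a _ ab] : range i b.
    by apply: contrapT => nib; apply: ib; exists b.
  by exists a => // w wn; rewrite (ext_type iext) ab; exact: bP.
- move=> p z infA.
  have [n|c [njc cp cz]] := ext_realize jext (p := p) z.
    exact: agrees_image iext _ _ (infA n).
  by exists c; split=> // -[a _ ac]; apply: njc; exists (i a).
Qed.

End Presentations.

(** * Transporting valuations between saturated extensions *)

Section Transport.
Variables (E S : finType) (A B1 B2 : structure).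
Variables (PA : presentation E S A) (P1 : presentation E S B1)
  (P2 : presentation E S B2) (i1 : A -> B1) (i2 : A -> B2).
Hypotheses (ext1 : saturated_extension PA P1 i1)
  (ext2 : saturated_extension PA P2 i2).

(** The value at z is the end of any word from y that leads from x to z; the
    type of x tells that such a word is defined at y and that its end depends
    on z only. *)
Lemma component_transport x y : same_type P1 P2 x y ->
  exists g : B1 -> B2, forall w z, run P1 w x z -> run P2 w y (g z).
Proof.
move=> xy.
suff /choice[g gP] : forall z, exists t, forall w, run P1 w x z -> run P2 w y t.
  by exists g => w z; apply: gP.
move=> z; have [[v xz]|nxz] := pselect (connected P1 x z); last first.
  by exists y => w xz; case: nxz; exists w.
have /run_defined/xy/run_defined[t yt] : exists z, run P1 v x z by exists z.
exists t => w xz'.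
have /run_defined/xy/run_defined[t' yt'] : exists z, run P1 w x z by exists z.
by rewrite (proj2 (run_compare yt yt')) //; apply/xy/(run_compare xz xz').
Qed.

Lemma same_type_run x y w z t :
  same_type P1 P2 x y -> run P1 w x z -> run P2 w y t -> same_type P1 P2 z t.
Proof.
by move=> xy xz yt v; rewrite (run_conj v xz) (run_conj v yt).
Qed.

(** Such a map is an isomorphism from every component onto a component. It need
    be neither injective nor surjective. *)
Record type_morphism (f : B1 -> B2) : Prop := {
  tm_base : forall a, f (i1 a) = i2 a;
  tm_type : forall x, same_type P1 P2 x (f x);
  tm_run : forall w x x', run P1 w x x' -> run P2 w (f x) (f x')
}.

(** Components are independent of each other: choose a representative of each,
    send it to a point of the same type, and extend by component_transport. *)
Lemma type_morphism_exists : exists f, type_morphism f.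
Proof.
have [r rP] := @choice {C : set B1 | exists x, C x} B1
  (fun C => proj1_sig C) (fun C => proj2_sig C).
pose rep z : B1 :=
  r (exist _ (connected P1 z) (ex_intro _ z (connected_refl P1 z))).
(* rep depends only on the component, because r is applied to the component
   as a set. *)
have repP z : connected P1 (rep z) z.
  by apply: connected_sym; exact: (rP (exist _ (connected P1 z) _)).
have rep_eq z z' : connected P1 z z' -> rep z = rep z'.
  move=> zz'; congr r; apply/eq_exist/seteqP; split=> t.
    exact/connected_trans/connected_sym.
  exact: connected_trans.
have /choice[t tP] x : exists y : B2,
    same_type P1 P2 x y /\ forall a, x = i1 a -> y = i2 a.
  have [[a _ ax]|nx] := pselect (range i1 x).
    exists (i2 a); split=> [w|a' xa'].
      by rewrite -ax -(ext_type ext1) -(ext_type ext2).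
    by congr i2; apply: (ext_inj ext1); rewrite ax.
  have infA := ext_approx ext1 nx.
  have [a _] := infinite_setN0 (infA 0).
  have [y [_ yx _]] := ext_realize ext2 (fun=> i2 a) infA.
  exists y; split=> [w|a' xa']; first by rewrite yx.
  by case: nx; exists a'.
have /choice[g gP] z : exists g : B1 -> B2,
    forall w z', run P1 w z z' -> run P2 w (t z) (g z').
  by apply: component_transport; have [] := tP z.
exists (fun z => g (rep z) z); split=> [a|x|w x x' xx'].
- have [w aw] := connected_sym (repP (i1 a)).
  have [a' ra' aa'] := (ext_run ext1 _ _ _).1 aw.
  have ta' : t (rep (i1 a)) = i2 a' by apply: (tP _).2.
  have /run_backward/gP := aw.
  rewrite ta' run_backward => wga; apply: run_inj wga _.
  by apply/(ext_run ext2); exists a'.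
- have [w xw] := repP x.
  exact: same_type_run (tP _).1 xw (gP _ _ _ xw).
- have [v xv] := repP x.
  have <- : rep x = rep x' by apply: rep_eq; exists w.
  have /gP/run_cat[y ry] : run P1 (v ++ w) (rep x) x'.
    by apply/run_cat; exists x.
  by rewrite (run_fun ry (gP _ _ _ xv)).
Qed.

Lemma type_morphism_update f x b : type_morphism f ->
  ~ range i1 x -> same_type P1 P2 x b ->
  exists f', [/\ type_morphism f', f' x = b
    & forall z, ~ connected P1 z x -> f' z = f z].
Proof.
move=> fmor nx xb; have [g gP] := component_transport xb.
pose f' z := if `[< connected P1 x z >] then g z else f z.
have f'in z : connected P1 x z -> f' z = g z by rewrite /f'; case: asboolP.
have f'out z : ~ connected P1 x z -> f' z = f z by rewrite /f'; case: asboolP.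
exists f'; split=> [|//|z nzx]; last by apply: f'out => /connected_sym.
  split=> [a|z|w z z' zz'].
  - rewrite f'out ?(tm_base fmor) // => /connected_sym[w].
    by move=> /(ext_run ext1)[a' xa' _]; apply: nx; exists a'.
  - have [[w xz]|/f'out->] := pselect (connected P1 x z); last exact: tm_type.
    by rewrite f'in; [apply: same_type_run xb xz (gP _ _ xz)|exists w].
  have [[v xz]|nxz] := pselect (connected P1 x z).
    have xz' : run P1 (v ++ w) x z' by apply/run_cat; exists z.
    rewrite !f'in; [|by exists (v ++ w)|by exists v].
    have /run_cat[y ry] := gP _ _ xz'.
    by rewrite (run_fun ry (gP _ _ xz)).
  rewrite !f'out //; first exact: tm_run.
  by move=> xz'; apply/nxz/(connected_trans xz')/connected_sym; exists w.
by rewrite f'in; [apply: esym; apply: (gP [::])|apply: connected_refl].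
Qed.

(** A missing point b is new, so its type is realized by a new point x of B1
    away from the components of chosen preimages of the other points, and f
    can be redefined on the component of x so that x is sent to b. *)
Lemma type_morphism_onto (ws : seq B2) :
  exists2 f, type_morphism f & forall y, List.In y ws -> range f y.
Proof.
elim: ws => [|b ws [f fmor fws]]; first by have [f] := type_morphism_exists; exists f.
have [fb|nfb] := pselect (range f b).
  by exists f => // y [<-|/fws].
have ni2b : ~ range i2 b.
  by move=> [a _ ab]; apply: nfb; exists (i1 a); rewrite ?(tm_base fmor).
have infA := ext_approx ext2 ni2b.
have [a0 _] := infinite_setN0 (infA 0).
have /choice[h hP] y : exists x, List.In y ws -> f x = y.
  have [/fws[x _ fx]|nws] := pselect (List.In y ws); first by exists x.
  by exists (i1 a0).
pose z k := h (List.nth k ws b).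
have [x [nx xb xz]] := ext_realize ext1 z infA.
have [f' [f'mor f'x f'out]] := type_morphism_update fmor nx xb.
exists f' => // y [<-|yws]; first by exists x.
exists (h y) => //; rewrite f'out ?hP //.
by have [k [_ <-]] := List.In_nth ws y b yws; apply: xz.
Qed.

Lemma tm_special f s : type_morphism f -> f (special P1 s) = special P2 s.
Proof.
move=> fmor; pose w : word E S := [:: (inr (s, None), true)].
have /(tm_type fmor)[_ [-> //]] : run P1 w (special P1 s) (special P1 s).
by exists (special P1 s).
Qed.

Lemma tm_mark f m x : type_morphism f -> mark P1 m x <-> mark P2 m (f x).
Proof.
move=> fmor; pose w : word E S := [:: (inr m, true)].
have wP B (P : presentation E S B) y : mark P m y <-> run P w y y.
  by split=> [my|[_ [_ my] _]] //; exists y.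
by rewrite !wP; apply: tm_type.
Qed.

Lemma tm_edge f x x' : type_morphism f -> edge x x' -> edge (f x) (f x').
Proof.
move=> fmor xx'.
have [[e exx']|[s xs]|[s xs]] := edge_cases P1 xx'.
- have : run P1 [:: (inl e, true)] x x' by exists x'.
  by move=> /(tm_run fmor)[z /move_edge fxz <-].
- have /(tm_mark (s, Some true) x' fmor) : edge (special P1 s) x' by rewrite -xs.
  by rewrite /mark /= -(tm_special s fmor) -xs.
- have /(tm_mark (s, Some false) x fmor) : edge x (special P1 s) by rewrite -xs.
  by rewrite /mark /= -(tm_special s fmor) -xs.
Qed.

(** Only successors of a special node may lack a preimage: all other edges are
    moves or marks, which the type of x records. *)
Lemma tm_back f x y : type_morphism f -> edge (f x) y ->
  (exists2 x', edge x x' & f x' = y) \/ exists s, x = special P1 s.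
Proof.
move=> fmor fxy; have [[e efxy]|[s fxs]|[s ys]] := edge_cases P2 fxy.
- left; pose w : word E S := [:: (inl e, true)].
  have wfxy : run P2 w (f x) y by exists y.
  have /run_defined/(tm_type fmor)/run_defined[x' wxx'] :
    exists y, run P2 w (f x) y by exists y.
  exists x'; first by case: wxx' => z exz <-; apply: move_edge exz.
  by apply: run_fun (tm_run fmor wxx') wfxy.
- by right; exists s; apply/(tm_mark (s, None) x fmor).
- left; exists (special P1 s); last by rewrite tm_special.
  by apply/(tm_mark (s, Some false) x fmor); rewrite /mark /= -ys.
Qed.

(** Only diamonds at special nodes can fail to be reflected by f, and for each
    of the finitely many special nodes one witness in the image suffices for a
    given diamond. *)
Lemma truth_transfer (Var : Type) (V : Var -> set B2) (phi : formula Var) :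
  exists ws : seq B2, forall f, type_morphism f ->
    (forall y, List.In y ws -> range f y) ->
    forall x, true_at (fun p => f @^-1` V p) x phi <-> true_at V (f x) phi.
Proof.
elim: phi => [p||psi [ws IH]|psi [ws IH] chi [ws' IH']|psi [ws IH]].
- by exists [::].
- by exists [::].
- by exists ws => f fmor fws x /=; rewrite IH.
- exists (ws ++ ws') => f fmor fws x /=.
  rewrite IH ?IH' // => y yws; apply: fws; apply/List.in_app_iff; by [left|right].
have /choice[c cP] s : exists ys : seq B2,
    (exists2 y, edge (special P2 s) y & true_at V y psi) ->
    exists y, [/\ List.In y ys, edge (special P2 s) y & true_at V y psi].
  have [[y sy py]|] := pselect (exists2 y, edge (special P2 s) y & true_at V y psi).
    by exists [:: y] => _; exists y; split=> //; left.
  by exists [::].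
exists (ws ++ flatten [seq c s | s <- enum S]) => f fmor fws x /=.
have {}IH x' : true_at (fun p => f @^-1` V p) x' psi <-> true_at V (f x') psi.
  by apply: IH => // y yws; apply: fws; apply/List.in_app_iff; left.
split=> [[x' xx' /IH px']|[y fxy py]].
  by exists (f x') => //; apply: tm_edge.
have [[x' xx' fx'y]|[s xs]] := tm_back fmor fxy.
  by exists x' => //; apply/IH; rewrite fx'y.
subst x; rewrite tm_special // in fxy.
have [|y' [y'c sy' py']] := cP s; first by exists y.
have [|x' _ fx'] := fws y'.
  apply/List.in_app_iff; right.
  have : s \in enum S by rewrite mem_enum.
  elim: (enum S) => //= s' l IHl; rewrite inE => /predU1P[<-|/IHl ?];
    apply/List.in_app_iff; [by left|by right].
exists x'; last by apply/IH; rewrite fx'.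
apply/(tm_mark (s, Some true) x' fmor); by rewrite /mark /= fx'.
Qed.

Lemma Lambda_transfer (Var : Type) : Lambda Var B1 `<=` Lambda Var B2.
Proof.
move=> phi phiB1 V y.
have [ws wsP] := truth_transfer V phi.
have [f fmor fws] := type_morphism_onto (y :: ws).
have [x _ <-] : range f y by apply: fws; left.
by apply/(wsP f fmor) => [z zws|]; [apply: fws; right|apply: phiB1].
Qed.

End Transport.

Lemma Lambda_saturated (Var : Type) (E S : finType) (A B1 B2 : structure)
    (PA : presentation E S A) (P1 : presentation E S B1)
    (P2 : presentation E S B2) i1 i2 :
  saturated_extension PA P1 i1 -> saturated_extension PA P2 i2 ->
  Lambda Var B1 = Lambda Var B2.
Proof.
move=> ext1 ext2; apply/seteqP; split.
  exact: (@Lambda_transfer _ _ _ _ _ _ _ _ _ _ ext1 ext2 Var).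
exact: (@Lambda_transfer _ _ _ _ _ _ _ _ _ _ ext2 ext1 Var).
Qed.

(** * Pushing ultrafilters along partial injections *)

#[local] Instance ue_ultra (A : structure) (u : ue A) :
  UltraFilter (proj1_sig u) := proj2_sig u.

Section Push.
Variable A : structure.
Implicit Types (u v : ue A) (r s : A -> A -> Prop) (X Y : set A).

Lemma ue_ext u v : proj1_sig u `<=` proj1_sig v -> u = v.
Proof.
case: u v => [F FU] [G GU] /= FG; apply: eq_exist.
by apply: esym; apply: (max_filter _ FG).
Qed.

Definition pre r Y : set A := [set x | exists2 y, Y y & r x y].
Definition post r X : set A := [set y | exists2 x, X x & r x y].

(** For a partial injection r, v is the image of u under r, defined when the
    domain of r belongs to u. *)
Definition pushed r u v : Prop :=
  forall Y, proj1_sig v Y <-> proj1_sig u (pre r Y).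

Lemma pushed_dom r u v :
  pushed r u v -> proj1_sig u [set x | exists y, r x y].
Proof.
move=> /(_ setT)[/(_ filterT) uT _].
by apply: filterS uT => x [y _ xy]; exists y.
Qed.

Lemma pushed_post r u v : pushed r u v ->
  forall X, proj1_sig u X -> proj1_sig v (post r X).
Proof.
move=> ruv X uX; apply/ruv.
apply: filterS (filterI uX (pushed_dom ruv)) => x [Xx [y xy]].
by exists y => //; exists x.
Qed.

Lemma post_pushed r u v : partial_injection r ->
  (forall X, proj1_sig u X -> proj1_sig v (post r X)) -> pushed r u v.
Proof.
move=> [rfun _] ruv Y; split=> [vY|/ruv vrY].
  apply: contrapT => /(ultraC (ue_ultra u))/ruv vr.
  have [y [Yy [x nx xy]]] := ultra_meet (ue_ultra v) vY vr.
  by apply: nx; exists y.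
by apply: filterS vrY => y [x [y' Yy' xy'] xy]; rewrite (rfun _ _ _ xy xy').
Qed.

Lemma pushed_converse r u v : partial_injection r ->
  pushed r u v -> pushed (fun x y => r y x) v u.
Proof.
move=> rp ruv X; split; first exact: pushed_post.
have [_ rinj] := rp.
move=> /ruv; apply: filterS => x [y [x' Xx' x'y] xy].
by rewrite (rinj _ _ _ xy x'y).
Qed.

Lemma pushed_converse_iff r u v : partial_injection r ->
  pushed (fun x y => r y x) u v <-> pushed r v u.
Proof.
move=> rp; split; last exact: pushed_converse.
exact: (pushed_converse (partial_injection_converse rp)).
Qed.

Lemma pushed_fun r u v v' : pushed r u v -> pushed r u v' -> v = v'.
Proof. by move=> ruv ruv'; apply: ue_ext => Y /ruv/ruv'. Qed.

Lemma pushed_pinj r : partial_injection r -> partial_injection (pushed r).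
Proof.
move=> rp; split=> [u v v'|u u' v]; first exact: pushed_fun.
by move=> /(pushed_converse rp) h /(pushed_converse rp); apply: pushed_fun h.
Qed.

Lemma pushed_exists r u : partial_injection r ->
  proj1_sig u [set x | exists y, r x y] -> exists v, pushed r u v.
Proof.
move=> [rfun _] udom.
suff FU : UltraFilter (fun Y => proj1_sig u (pre r Y)) by exists (exist _ _ FU).
apply: ultra_intro => [X Y uX XY|X Y uX uY|X|].
- by apply: filterS uX => x [y /XY Yy xy]; exists y.
- apply: filterS (filterI uX uY) => x [[y Xy xy] [y' Yy' xy']].
  by exists y => //; split; rewrite // (rfun _ _ _ xy xy').
- split=> [uC uX|/(ultraC (ue_ultra u)) uC].
    have [x [[y nXy xy] [y' Xy' xy']]] := ultra_meet (ue_ultra u) uC uX.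
    by apply: nXy; rewrite (rfun _ _ _ xy xy').
  apply: filterS (filterI uC udom) => x [nX [y xy]].
  by exists y => // Xy; apply: nX; exists y.
- by apply: filterS udom => x [y xy]; exists y.
Qed.

Lemma pushed_comp r s u v : partial_injection r ->
  pushed (fun x y => exists2 z, r x z & s z y) u v <->
  exists2 w, pushed r u w & pushed s w v.
Proof.
have preE Y : pre (fun x y => exists2 z, r x z & s z y) Y = pre r (pre s Y).
  apply/seteqP; split=> x [y].
    by move=> Yy [z xz zy]; exists z => //; exists y.
  by move=> [t Yt yt] xy; exists t => //; exists y.
move=> rp; split=> [rsuv|[w ruw swv] Y]; last by rewrite preE swv ruw.
have [|w ruw] := @pushed_exists r u rp.
  by apply: filterS (pushed_dom rsuv) => x [y [z xz _]]; exists z.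
by exists w => // Y; rewrite rsuv preE ruw.
Qed.

Lemma pushed_partial_id (P : set A) u v :
  pushed (fun x y => x = y /\ P x) u v <-> u = v /\ proj1_sig u P.
Proof.
have preE Y : pre (fun x y => x = y /\ P x) Y = Y `&` P.
  apply/seteqP; split=> x; first by move=> [y Yy [-> Py]].
  by move=> [Yx Px]; exists x.
split=> [puv|[<- uP] Y]; rewrite ?preE.
  split; last by apply: filterS (pushed_dom puv) => x [y [_ Px]].
  by apply/esym/ue_ext => Y /puv; rewrite preE; apply: filterS => x [].
by split=> [uY|]; [apply: filterI|apply: filterS => x []].
Qed.

Lemma pushed_eq u v : pushed (fun x y => x = y) u v <-> u = v.
Proof.
have -> : (fun x y : A => x = y) = (fun x y => x = y /\ setT x).
  by apply/funext => x; apply/funext => y; apply/propext; split=> [|[]].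
by rewrite pushed_partial_id; split=> [[]|] // uv; split=> //; apply: filterT.
Qed.

(** If the points fixed by r do not form a set of u, then one of the three sets
    of three_sets belongs to u; so does its preimage, as u is its own image,
    although the two are disjoint. *)
Lemma pushed_self r u : partial_injection r ->
  pushed r u u <-> proj1_sig u [set x | r x x].
Proof.
move=> rp; have [rfun _] := rp; split=> [ruu|ufix Y].
  apply: contrapT => /(ultraC (ue_ultra u)) nfix.
  have [Y [Ycover Yindep]] := three_sets rp.
  have [k uYk] : exists k, proj1_sig u (Y k).
    apply: ultra_exists.
    by apply: filterS (filterI (pushed_dom ruu) nfix) => x [dx nxx]; apply: Ycover.
  have /ruu uYk' := uYk.
  have [x [Yx [y Yy xy]]] := ultra_meet (ue_ultra u) uYk uYk'.
  exact: Yindep Yx xy Yy.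
split=> uY; apply: filterS (filterI ufix uY) => x [xx].
  by exists x.
by move=> [y Yy xy]; rewrite (rfun _ _ _ xx xy).
Qed.

Definition principal (a : A) : ue A :=
  exist _ _ (principal_filter_ultra a).

Lemma principalP a X : proj1_sig (principal a) X <-> X a.
Proof.
by rewrite /principal /=; split=> [/principal_filterP|?]; last exact/principal_filterP.
Qed.

Lemma ue_principal u a : proj1_sig u [set a] -> u = principal a.
Proof.
move=> ua; apply: esym; apply: ue_ext => X /principalP Xa.
by apply: filterS ua => _ ->.
Qed.

Lemma principal_inj : injective principal.
Proof.
move=> a b ab; have /principalP : proj1_sig (principal b) [set a].
  by rewrite -ab; apply/principalP.
by move=> /= ->.
Qed.

Lemma pushed_principal r a v : partial_injection r ->
  pushed r (principal a) v <-> exists2 b, v = principal b & r a b.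
Proof.
move=> [rfun _]; split=> [rav|[b -> ab] Y].
  have /principalP[b ab] := pushed_dom rav.
  exists b => //; apply: esym; apply: ue_ext => Y /principalP Yb.
  by apply/rav/principalP; exists b.
rewrite !principalP; split=> [Yb|[b' Yb' ab']]; first by exists b.
by rewrite (rfun _ _ _ ab ab').
Qed.

Lemma edge_principal_l a u :
  edge (principal a) u <-> proj1_sig u [set x | edge a x].
Proof.
split=> [au|ua _ [X /principalP Xa <-]].
  apply: filterS (au _ _) => [|]; last first.
    by exists [set a] => //; apply/principalP.
  by move=> x [_ ->].
by apply: filterS ua => x ax; exists a.
Qed.

Lemma edge_principal_r a u :
  edge u (principal a) <-> proj1_sig u [set x | edge x a].
Proof.
split=> [ua|ua _ [X uX <-]].
  apply: contrapT => /(ultraC (ue_ultra u)) nua.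
  have /principalP[x nxa xa] :
      proj1_sig (principal a) (rel_image (~` [set x | edge x a])).
    by apply: ua; exists (~` [set x | edge x a]).
  exact: nxa.
have [x [Xx xa]] := ultra_meet (ue_ultra u) uX ua.
by apply/principalP; exists x.
Qed.

End Push.

(** * Ultrafilter extensions are saturated *)

Section UltrafilterExtension.
Variables (E S : finType) (A : structure) (PA : presentation E S A).

Lemma ue_move_edge e (u v : ue A) : pushed (move PA e) u v -> edge u v.
Proof.
move=> euv _ [X uX <-]; apply: filterS (pushed_post euv uX) => y [x Xx xy].
by exists x => //; apply: move_edge xy.
Qed.

(** If every move e fails from u to v, some X e in u has its e-image outside v.
    On the intersection of these finitely many sets, and away from the special
    nodes, every edge is a move, so the image of that intersection cannot
    belong to v. *)
Lemma ue_edge_cases (u v : ue A) : edge u v ->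
  [\/ exists e, pushed (move PA e) u v,
      exists s, u = principal (special PA s)
    | exists s, v = principal (special PA s)].
Proof.
move=> uv; apply: contrapT => ncases.
have nmove e : ~ pushed (move PA e) u v.
  by move=> euv; apply: ncases; apply: Or31; exists e.
have nu s : u <> principal (special PA s).
  by move=> us; apply: ncases; apply: Or32; exists s.
have nv s : v <> principal (special PA s).
  by move=> vs; apply: ncases; apply: Or33; exists s.
have ordinary (w : ue A) : (forall s, w <> principal (special PA s)) ->
    \forall x \near proj1_sig w, forall s, x <> special PA s.
  move=> nw; apply: filter_forall => s; apply/(ultraC (ue_ultra w)) => ws.
  exact/(nw s)/ue_principal.
have /choice[X XP] e : exists X, proj1_sig u X /\ ~ proj1_sig v (post (move PA e) X).
  apply: contrapT => /forallNP nX; apply: (nmove e); apply: post_pushed.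
    exact: move_pinj.
  by move=> X uX; apply: contrapT => nvX; apply: (nX X).
have uX : \forall x \near proj1_sig u, forall e, X e x.
  by apply: filter_forall => e; have [] := XP e.
have uXo := filterI uX (ordinary u nu).
have vX : proj1_sig v (rel_image
    [set x | (forall e, X e x) /\ (forall s, x <> special PA s)]).
  by apply: uv; eexists; first exact: uXo.
suff [e ve] : exists e, proj1_sig v (post (move PA e) (X e)) by have [_] := XP e.
apply: ultra_exists.
apply: filterS (filterI vX (ordinary v nv)) => y [[x [Xx nx] xy] ny].
have [[e exy]|[s xs]|[s ys]] := edge_cases PA xy.
- by exists e; exists x.
- by case: (nx s).
- by case: (ny s).
Qed.

Definition ue_presentation : presentation E S (ue A) :=
  @Presentation E S (ue A) (fun e => pushed (move PA e))
    (fun s => principal (special PA s)) (fun e => pushed_pinj (move_pinj PA e))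
    ue_move_edge ue_edge_cases.

Lemma ue_step l (u v : ue A) :
  step ue_presentation l u v <-> pushed (step PA l) u v.
Proof.
case: l => [//|[s k]]; rewrite /= pushed_partial_id.
suff -> : mark ue_presentation (s, k) u <-> proj1_sig u (mark PA (s, k)) by [].
case: k => [[|]|] /=.
- exact: edge_principal_l.
- exact: edge_principal_r.
- split=> [->|]; first exact/principalP.
  exact: ue_principal.
Qed.

Lemma ue_run w (u v : ue A) : run ue_presentation w u v <-> pushed (run PA w) u v.
Proof.
have ue_dstep d (u' v' : ue A) :
    dstep ue_presentation d u' v' <-> pushed (dstep PA d) u' v'.
  case: d => l [|]; first exact: ue_step.
  apply: iff_trans (ue_step l v' u') (iff_sym _).
  exact/pushed_converse_iff/step_pinj.
elim: w u v => [|d w IHw] u v /=; first by rewrite pushed_eq.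
rewrite pushed_comp; last exact: dstep_pinj.
by split=> -[z /ue_dstep uz /IHw zv]; exists z.
Qed.

Lemma ue_run_self w (u : ue A) :
  run ue_presentation w u u <-> proj1_sig u [set x | run PA w x x].
Proof. by rewrite ue_run pushed_self //; apply: run_pinj. Qed.

Lemma filter_agrees (F : set_system A) n (p : word E S -> Prop) : UltraFilter F ->
  (forall w, F [set x | run PA w x x] <-> p w) -> F (agrees PA n p).
Proof.
move=> FU Fp.
have : \forall x \near F, forall k : 'I_n,
    forall w, unpickle k = Some w -> (run PA w x x <-> p w).
  apply: filter_forall => k; case: unpickle => [w|]; last by apply: filterE.
  have [pw|npw] := pselect (p w).
    by have /Fp := pw; apply: filterS => x xx _ [<-].
  have /(ultraC FU) : ~ F [set x | run PA w x x] by rewrite Fp.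
  by apply: filterS => x xx _ [<-].
apply: filterS => x xP w wn; apply: (xP (Ordinal wn)).
by rewrite /= pickleK.
Qed.

Lemma ue_saturated : saturated_extension PA ue_presentation (@principal A).
Proof.
split.
- exact: principal_inj.
- by move=> w a u; rewrite ue_run pushed_principal //; apply: run_pinj.
- move=> u nu n finX.
  have uX : proj1_sig u (agrees PA n (fun w => run ue_presentation w u u)).
    by apply: filter_agrees => w; rewrite ue_run_self.
  have [a /ue_principal ua] := ultra_finite_set (ue_ultra u) finX uX.
  by apply: nu; exists a.
- move=> p z infX; have [a [a_inj aX]] := infinite_sets_choice infX.
  (* v enumerates the images of the ultrafilters z k under all words w, that
     is, all points in the components to be avoided; where w is undefined at
     z k, the set system contains no set at all. *)
  pose v m : set_system A :=
    if unpickle m is Some (k, w) then fun Y => proj1_sig (z k) (pre (run PA w) Y)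
    else fun=> False.
  have v_disj m X Y : v m X -> v m Y -> X `&` Y !=set0.
    rewrite /v; case: unpickle => [[k w]|//] vX vY.
    have [x [[y Xy xy] [y' Yy' xy']]] := ultra_meet (ue_ultra (z k)) vX vY.
    by exists y; split=> //; rewrite (run_fun xy xy').
  have [U [UU Ua Uv]] := ultra_diagonal a_inj v_disj.
  have UX n : U (agrees PA n p).
    apply: filterS (Ua n) => _ [m /= nm <-]; exact: agrees_antimono nm _ (aX m).
  exists (exist _ U UU : ue A); split=> [[b _ bU]|w|k [w zU]].
  + have Ub : U [set b].
      by have /principalP : [set b] b by []; rewrite bU.
    have [_ [-> [m _ mb]]] := ultra_meet UU Ub (Ua 0).
    have [_ [-> [m' /= mm']]] := ultra_meet UU Ub (Ua m.+1).
    by rewrite -mb => /a_inj; lia.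
  + rewrite ue_run_self /=.
    have Uw := UX (code w).+1.
    split=> [Uww|pw].
      by have [x [xx /(_ w (leqnn _))[+ _]]] := ultra_meet UU Uww Uw; apply.
    by apply: filterS Uw => x /(_ w (leqnn _))[_]; apply.
  + have [Y UY] := Uv (pickle (k, w)).
    have /ue_run/(_ Y)[/(_ UY) zY _] := zU.
    by rewrite /v pickleK; apply.
Qed.

End UltrafilterExtension.

(** * Ultrapowers are saturated *)

Section Ultrapower.
Variables (A : structure) (I : Type) (D : set_system I).
Hypothesis DU : UltraFilter D.

Local Notation Astar := (ultrapower A D).
Implicit Types (r : A -> A -> Prop) (f g : I -> A) (C : Astar).

Definition cls f : Astar :=
  exist _ [set g | eq_mod D f g] (ex_intro _ f erefl).

Lemma cls_surj C : exists f, C = cls f.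
Proof.
case: C => C [f Cf]; exists f; apply: eq_exist.
by rewrite Cf.
Qed.

Lemma eq_modP f g : cls f = cls g <-> D [set i | f i = g i].
Proof.
split=> [fg|fg].
  have : proj1_sig (cls g) g by apply: filterE.
  by rewrite -fg.
apply/eq_exist/seteqP; split=> h /= fh; apply: filterS (filterI fg fh) => i.
  by move=> [/= <-].
by move=> [/= ->].
Qed.

Definition lifted r C C' : Prop :=
  exists f g, [/\ proj1_sig C f, proj1_sig C' g & D [set i | r (f i) (g i)]].

Lemma liftedP r f g : lifted r (cls f) (cls g) <-> D [set i | r (f i) (g i)].
Proof.
split=> [[f' [g' [ff' gg' rfg]]]|rfg].
  by apply: filterS (filterI (filterI ff' gg') rfg) => i [[/= -> ->]].
by exists f, g; split=> //; apply: filterE.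
Qed.

Lemma lifted_pinj r : partial_injection r -> partial_injection (lifted r).
Proof.
move=> [rfun rinj]; split=> C1 C2 C3; have [f ->] := cls_surj C1;
  have [g ->] := cls_surj C2; have [h ->] := cls_surj C3;
  move=> /liftedP r1 /liftedP r2; apply/eq_modP;
  apply: filterS (filterI r1 r2) => i [/= ri1 ri2].
  exact: rfun ri1 ri2.
exact: rinj ri1 ri2.
Qed.

(** Together with ultrapower_run this is the part of Los's theorem that words
    need; intermediate points are chosen coordinatewise. *)
Lemma lifted_comp r (s : A -> A -> Prop) C C' :
  lifted (fun x y => exists2 z, r x z & s z y) C C' <->
  exists2 C'', lifted r C C'' & lifted s C'' C'.
Proof.
have [f ->] := cls_surj C; have [g ->] := cls_surj C'.
split=> [/liftedP rs|[C'']]; last first.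
  have [h ->] := cls_surj C''; move=> /liftedP rh /liftedP hs; apply/liftedP.
  by apply: filterS (filterI rh hs) => i [/= ri si]; exists (h i).
have /choice[h hP] i : exists z, (exists2 z, r (f i) z & s z (g i)) ->
    r (f i) z /\ s z (g i).
  have [[z rz sz]|] := pselect (exists2 z, r (f i) z & s z (g i)); first by exists z.
  by exists (f i).
exists (cls h); apply/liftedP; apply: filterS rs => i /hP[] //.
Qed.

Definition constant_class (a : A) : Astar := cls (fun=> a).

Lemma ultrapower_move_edge r : (forall x y, r x y -> edge x y) ->
  forall C C', lifted r C C' -> edge C C'.
Proof.
move=> redge C C' [f [g [Cf Cg rfg]]]; exists f, g; split=> //.
by apply: filterS rfg => i /redge.
Qed.

Variables (E S : finType) (PA : presentation E S A).

Lemma ultrapower_edge_cases (C C' : Astar) : edge C C' ->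
  [\/ exists e, lifted (move PA e) C C',
      exists s, C = constant_class (special PA s)
    | exists s, C' = constant_class (special PA s)].
Proof.
have [f ->] := cls_surj C; have [g ->] := cls_surj C'.
move=> /(liftedP (@edge A)) fg.
have : D ([set i | exists e, move PA e (f i) (g i)] `|`
    ([set i | exists s, f i = special PA s] `|`
     [set i | exists s, g i = special PA s])).
  by apply: filterS fg => i /(edge_cases PA)[]; [left|right; left|right; right].
move=> /(ultra_or DU)[De|/(ultra_or DU)[Ds|Ds]].
- by have [e eD] := ultra_exists DU De; apply: Or31; exists e; apply/liftedP.
- by have [s sD] := ultra_exists DU Ds; apply: Or32; exists s; apply/eq_modP.
- by have [s sD] := ultra_exists DU Ds; apply: Or33; exists s; apply/eq_modP.
Qed.

Definition ultrapower_presentation : presentation E S Astar :=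
  @Presentation E S Astar (fun e => lifted (move PA e))
    (fun s => constant_class (special PA s))
    (fun e => lifted_pinj (move_pinj PA e))
    (fun e => ultrapower_move_edge (@move_edge E S A PA e))
    ultrapower_edge_cases.

Local Notation Pstar := ultrapower_presentation.

Lemma ultrapower_step l C C' : step Pstar l C C' <-> lifted (step PA l) C C'.
Proof.
case: l => [//|[s k]] /=; have [f ->] := cls_surj C; have [g ->] := cls_surj C'.
rewrite liftedP eq_modP.
have -> : mark Pstar (s, k) (cls f) <-> D [set i | mark PA (s, k) (f i)].
  case: k => [[|]|] /=; rewrite /mark /=; last exact: eq_modP.
    exact: (liftedP (@edge A)).
  exact: (liftedP (@edge A)).
split=> [[fg fm]|fgm]; first by apply: filterS (filterI fg fm).
by split; apply: filterS fgm => i [].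
Qed.

Lemma ultrapower_run w f g :
  run Pstar w (cls f) (cls g) <-> D [set i | run PA w (f i) (g i)].
Proof.
rewrite -liftedP.
have lift_dstep d C C' : dstep Pstar d C C' <-> lifted (dstep PA d) C C'.
  case: d => l [|]; first exact: ultrapower_step.
  rewrite /dstep /= ultrapower_step.
  have [f' ->] := cls_surj C; have [g' ->] := cls_surj C'.
  by rewrite !liftedP.
elim: w (cls f) (cls g) => [|d w IHw] C C' /=.
  have [f' ->] := cls_surj C; have [g' ->] := cls_surj C'.
  by rewrite liftedP eq_modP.
rewrite lifted_comp.
by split=> -[z /lift_dstep uz /IHw zv]; exists z.
Qed.

Hypothesis Dincomplete : aleph1_incomplete D.

(** If every F n is in D but their intersection is not, almost every i is
    outside that intersection, and nu i can be the first n with i outside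
    F n. *)
Lemma incomplete_rank : exists nu : I -> nat, forall m, D [set i | m < nu i].
Proof.
have [F [FD nF]] := Dincomplete.
have /choice[nu nuP] i : exists n, ~ (\bigcap_n F n) i ->
    forall m, (forall k, k <= m -> F k i) -> m < n.
  have [Fi|nFi] := pselect ((\bigcap_n F n) i); first by exists 0.
  have [n nFn] : exists n, ~ F n i by apply/existsNP => Fi; apply: nFi.
  exists n => _ m Fm; rewrite ltnNge; apply/negP => /Fm //.
exists nu => m.
have : D [set i | forall k : 'I_m.+1, F k i] by apply: filter_forall => k.
have /(ultraC DU) nFD := nF.
move=> FmD; apply: filterS (filterI FmD nFD) => i [Fi nFi].
by apply: nuP => // k km; exact: (Fi (Ordinal (km : k < m.+1))).
Qed.

(** For ext_realize, the coordinate i of the new point is a term of a sequence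
    whose m-th term realizes the m-th finite part of p. It is taken at a rank
    at least nu i, and away from the finitely many points reached by words of
    code below nu i from the coordinates i of the first nu i classes to be
    avoided. As nu is almost everywhere larger than any given number, each
    requirement holds almost everywhere. *)
Lemma ultrapower_saturated : saturated_extension PA Pstar constant_class.
Proof.
split.
- by move=> a b /eq_modP/(@filter_ex _ D)[].
- move=> w a C; have [g ->] := cls_surj C.
  rewrite ultrapower_run; split=> [ag|[b /eq_modP gb ab]].
    have [i ai] := @filter_ex _ D _ _ ag; exists (g i) => //.
    by apply/eq_modP; apply: filterS ag => j aj; apply: run_fun aj ai.
  by apply: filterS gb => i /= ->.
- move=> C; have [f ->] := cls_surj C => nf n finX.
  pose Df : set_system A := fun X => D (f @^-1` X).
  have DfU : UltraFilter Df.
    apply: ultra_intro => [X Y DX XY|X Y|X|].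
    + by apply: filterS DX => i /XY.
    + exact: filterI.
    + exact: (ultraC DU (f @^-1` X)).
    + exact: filterT.
  have DfX : Df (agrees PA n (fun w => run Pstar w (cls f) (cls f))).
    by apply: filter_agrees => w; rewrite ultrapower_run.
  have [a fa] := ultra_finite_set DfU finX DfX.
  by apply: nf; exists a => //; apply/eq_modP; apply: filterS fa => i ->.
- move=> p z infX; have [a [a_inj aX]] := infinite_sets_choice infX.
  have [nu nuP] := incomplete_rank.
  have /choice[zf zfP] k := cls_surj (z k).
  have /choice[m mP] i : exists m, nu i <= m /\
      forall k w, k < nu i -> code w < nu i -> ~ run PA w (zf k i) (a m).
    pose bad k c : set nat :=
      [set m | exists2 w, unpickle c = Some w & run PA w (zf k i) (a m)].
    have fin_bad : finite_set (`I_(nu i) `|`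
        \bigcup_(k in `I_(nu i)) \bigcup_(c in `I_(nu i)) bad k c).
      rewrite finite_setU; split=> //.
      apply: bigcup_finite => // k _; apply: bigcup_finite => // c _.
      have [[m0 [w cw wm0]]|nm] := pselect (bad k c !=set0).
        apply: sub_finite_set (finite_set1 m0) => m [w' cw' wm].
        move: cw'; rewrite cw => -[ww']; subst w'.
        exact/a_inj/(run_fun wm wm0).
      rewrite (_ : bad k c = set0); first exact: finite_set0.
      by apply/seteqP; split=> // m bm; apply: nm; exists m.
    have [m [_ nbad]] := infinite_setN0 (infinite_setD infinite_nat fin_bad).
    exists m; split=> [|k w ki wi zm].
      by rewrite leqNgt; apply/negP => mi; apply: nbad; left.
    apply: nbad; right; exists k => //; exists (code w) => //.
    by exists w => //; rewrite /code pickleK.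
  exists (cls (a \o m)); split=> [[b _ /eq_modP ba]|w|k].
  + have [i0 /= ba0] := @filter_ex _ D _ _ ba.
    have [i [/= bi mi]] := ultra_meet DU ba (nuP (m i0)).
    by have [+ _] := mP i; move: bi; rewrite ba0 => /a_inj; lia.
  + rewrite ultrapower_run.
    have Dw : D [set i | run PA w (a (m i)) (a (m i)) <-> p w].
      apply: filterS (nuP (code w)) => i /= wi.
      by apply: (aX (m i)); have [] := mP i; lia.
    split=> [Dww|pw]; last by apply: filterS Dw => i [_]; apply.
    by have [i [ww [+ _]]] := ultra_meet DU Dww Dw; apply.
  + rewrite zfP => -[w /ultrapower_run zw].
    have [i [/= zi [/= ki wi]]] := ultra_meet DU zw (filterI (nuP k) (nuP (code w))).
    by have [_ /(_ k w ki wi)] := mP i.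
Qed.

End Ultrapower.

(** * Almost bounded structures are presentable *)

Lemma card_le_II_index T (X : set T) n : (X #<= `I_n)%card ->
  exists h : T -> nat, (forall x, X x -> h x < n) /\
    forall x y, X x -> X y -> h x = h y -> x = y.
Proof.
move=> /pcard_leP/injfunPex[h hX h_inj]; exists h; split=> [x Xx|x y Xx Xy].
  exact: hX.
by apply: h_inj; rewrite inE.
Qed.

(** An edge from x to y is labelled by the rank of y among the successors of x
    and the rank of x among the predecessors of y: the first rank makes the
    edges with a given label functional, the second injective. *)
Lemma almost_bounded_presentation (A : structure) : almost_bounded A ->
  exists (E S : finType), inhabited (presentation E S A).
Proof.
move=> [/finite_set_enum[k [c cP]] [n nP]].
have /choice[out outP] a : exists h : A -> nat, ~ infinite_degree a ->
    (forall x, edge a x -> h x < n) /\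
    forall x y, edge a x -> edge a y -> h x = h y -> x = y.
  have [ia|ia] := pselect (infinite_degree a); first by exists (fun=> 0).
  by have [/card_le_II_index[h hP] _] := nP a ia; exists h.
have /choice[inn innP] a : exists h : A -> nat, ~ infinite_degree a ->
    (forall x, edge x a -> h x < n) /\
    forall x y, edge x a -> edge y a -> h x = h y -> x = y.
  have [ia|ia] := pselect (infinite_degree a); first by exists (fun=> 0).
  by have [_ /card_le_II_index[h hP]] := nP a ia; exists h.
pose mv (e : 'I_n * 'I_n) x y :=
  [/\ edge x y, ~ infinite_degree x, ~ infinite_degree y, out x y = e.1
    & inn y x = e.2].
exists ('I_n * 'I_n)%type, 'I_k; constructor.
apply: (@Presentation _ _ A mv c) => [e|e x y []//|x y xy].
  split=> [x y y'|x x' y] [xy nx ny oxy ixy] [xy' nx' ny' oxy' ixy'].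
    by apply: ((outP x nx).2 _ _ xy xy'); rewrite oxy.
  by apply: ((innP y ny).2 _ _ xy xy'); rewrite ixy.
have [/cP ix|nx] := pselect (infinite_degree x); first exact: Or32.
have [/cP iy|ny] := pselect (infinite_degree y); first exact: Or33.
apply: Or31; have ltout := (outP x nx).1 y xy.
have ltinn := (innP y ny).1 x xy.
by exists (Ordinal ltout, Ordinal ltinn).
Qed.

Theorem theorem2p19 (Var : Type) (A : structure) (I : Type)
    (D : set_system I) :
  almost_bounded A -> UltraFilter D -> aleph1_incomplete D ->
  Lambda Var (ue A) = Lambda Var (ue (ue A)) /\
  Lambda Var (ue (ue A)) = Lambda Var (ultrapower A D).
Proof.
move=> /almost_bounded_presentation[E [S [PA]]] DU Dinc.
have ext1 := ue_saturated PA.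
have ext2 := saturated_extension_comp ext1 (ue_saturated (ue_presentation PA)).
have ext3 := ultrapower_saturated DU PA Dinc.
by split; [exact: Lambda_saturated ext1 ext2|exact: Lambda_saturated ext2 ext3].
Qed.
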